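(* Let $A\in\mathbb{C}^{n\times n}$ be Hermitian with eigenvalues $\lambda_1\ge\cdots\ge\lambda_n$. Let $\mathcal{Y}\subseteq\mathbb{C}^n$ be a subspace with $p=\dim\mathcal{Y}\ge1$, let $f$ be a scalar function defined on the eigenvalues of $A$, and let $\mathcal{Y}'=f(A)\mathcal{Y}$. Let $i\in\{1,\ldots,p\}$. Assume that the $i$th largest Ritz value $\eta_i$ of $A$ in $\mathcal{Y}$ is larger than $\lambda_{t+1}$ for a certain $t\in\{i,\ldots,n-p+i-1\}$, and that $|f(\lambda_1)|\ge\cdots\ge|f(\lambda_t)|>\max_{j\in\{t+1,\ldots,n\}}|f(\lambda_j)|$. Then $\dim\mathcal{Y}'\ge i$, and the $i$th largest Ritz value $\eta'_i$ of $A$ in $\mathcal{Y}'$ satisfies either $\eta'_i\ge\lambda_t$ or $$0<\frac{\lambda_t-\eta'_i}{\eta'_i-\lambda_{t+1}}\le\frac{\max_{j\in\{t+1,\ldots,n\}}|f(\lambda_j)|^2}{|f(\lambda_t)|^2}\ \frac{\lambda_t-\eta_i}{\eta_i-\lambda_{t+1}}.$$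
   Context: Eigenvalues are counted with multiplicity. With orthonormal eigenvectors $x_j$, $Ax_j=\lambda_jx_j$, the matrix function is $f(A)=\sum_{j=1}^n f(\lambda_j)x_jx_j^H$, and $f(A)\mathcal{U}=\{f(A)u:u\in\mathcal{U}\}$ for a subspace $\mathcal{U}$. For a subspace $\mathcal{U}\subseteq\mathbb{C}^n$ of dimension $d\ge1$ with orthonormal basis matrix $U\in\mathbb{C}^{n\times d}$ (Euclidean inner product), the Ritz values of $A$ in $\mathcal{U}$ are the $d$ eigenvalues (with multiplicity) of $U^HAU$; they do not depend on the choice of $U$. They are ordered decreasingly, so the $i$th largest Ritz value is the $i$th in this order. *)

(* Defs.v *)
From HB Require Import structures.
From mathcomp Require Import all_boot all_order all_algebra.
From mathcomp Require Import complex.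

Set Implicit Arguments.
Unset Strict Implicit.
Unset Printing Implicit Defensive.

Import Order.TTheory GRing.Theory Num.Theory.

Local Open Scope ring_scope.
Local Open Scope complex_scope.
Local Open Scope sesquilinear_scope.

Lemma char_poly_conj (F : comNzRingType) d (P Q M : 'M[F]_d) :
  P *m Q = 1%:M -> char_poly (P *m M *m Q) = char_poly M.
Proof.
move=> PQ; rewrite /char_poly.
have -> : char_poly_mx (P *m M *m Q) =
    map_mx polyC P *m char_poly_mx M *m map_mx polyC Q.
  rewrite /char_poly_mx mulmxBr mulmxBl !map_mxM; congr (_ - _).
  by rewrite mul_mx_scalar -scalemxAl -map_mxM PQ map_mx1 scalemx1.
rewrite !det_mulmx mulrAC -det_mulmx -map_mxM PQ map_mx1 det1 mul1r.
by [].
Qed.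

Section Ritz.
Variable R : rcfType.
Local Notation C := R[i].

(* The roots of the characteristic polynomial, with multiplicity, in decreasing
   order. Taking real parts makes the function total; it loses nothing when M
   is Hermitian, see [char_poly_eigenvalues]. *)
Definition eigenvalues d (M : 'M[C]_d) : seq R :=
  sort >=%R
    [seq complex.Re z | z <- sval (closed_field_poly_normal (char_poly M))].

(* Indices start at 1: [eigval A 1] is the largest eigenvalue. *)
Definition eigval d (M : 'M[C]_d) (j : nat) : R := (eigenvalues M)`_j.-1.

Lemma char_poly_eigenvalues d (M : 'M[C]_d) : M \is hermsymmx ->
  char_poly M = \prod_(x <- eigenvalues M) ('X - (x%:C)%:P).
Proof.
move=> hM; rewrite /eigenvalues.
case: (closed_field_poly_normal _) => r /= Dp.
have {}Dp : char_poly M = \prod_(z <- r) ('X - z%:P).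
  by rewrite {1}Dp (monicP (char_poly_monic M)) scale1r.
have rR z : z \in r -> z \is Num.real.
  rewrite -root_prod_XsubC -Dp.
  have /orthomx_spectralP {1}-> := hermitian_normalmx hM.
  rewrite char_poly_conj ?mulVmx ?spectral_unit//.
  rewrite char_poly_trig ?diag_mx_is_trig// /root horner_prod.
  case/prodf_eq0 => i _; rewrite !hornerE mxE eqxx mulr1n subr_eq0 => /eqP->.
  by have /mxOverP := hermitian_spectral_diag_real hM; apply.
rewrite (perm_big _ (permEl (perm_sort _ _))) big_map Dp.
by apply: eq_big_seq => z /rR zR; rewrite RRe_real.
Qed.

(* [spectralmx A] is unitary with orthonormal eigenvectors of A as the adjoints
   of its rows, and [spectral_diag A] lists the corresponding eigenvalues. Any
   other choice of orthonormal eigenvectors gives the same matrix, see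
   [matfunE]. *)
Definition matfun n (f : R -> C) (A : 'M[C]_n) : 'M[C]_n :=
  \sum_(j < n) f (complex.Re (spectral_diag A 0 j)) *:
    ((row j (spectralmx A))^t* *m row j (spectralmx A)).

Lemma matfunE n (f : R -> C) (A X : 'M[C]_n) (l : 'I_n -> R) :
    A \is hermsymmx -> X^t* *m X = 1%:M ->
    (forall j, A *m col j X = (l j)%:C *: col j X) ->
  matfun f A = \sum_(j < n) f (l j) *: (col j X *m (col j X)^t*).
Proof.
move=> hA XX AX; set P := spectralmx A; set D := spectral_diag A.
have PU : P \is unitarymx := spectral_unitarymx A.
have PP : P^t* *m P = 1%:M by apply: mulmx1C; apply/unitarymxP.
have AE : A = P^t* *m diag_mx D *m P.
  by have /orthomx_spectralP {1}-> := hermitian_normalmx hA; rewrite invmx_unitary.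
have sumE (u : 'I_n -> C) (Y : 'M[C]_n) :
    \sum_(j < n) u j *: (col j Y *m (col j Y)^t*) =
    Y *m diag_mx (\row_j u j) *m Y^t*.
  rewrite mul_mx_diag; apply/matrixP => a b; rewrite summxE [RHS]mxE.
  apply: eq_bigr => j _; rewrite !mxE big_ord1 !mxE mulrA.
  by rewrite [u j * _]mulrC.
pose L := \row_j (l j)%:C : 'rV[C]_n.
have AXL : A *m X = X *m diag_mx L.
  apply/matrixP => a b; have /matrixP/(_ a 0) := AX b.
  by rewrite mul_mx_diag colE mulmxA -!colE !mxE mulrC.
rewrite (sumE (fun j => f (l j))) /matfun -/P -/D.
have -> : \sum_(j < n) f (complex.Re (D 0 j)) *: ((row j P)^t* *m row j P) =
    \sum_(j < n) f (complex.Re (D 0 j)) *: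
       (col j (P^t*) *m (col j (P^t*))^t*).
  apply: eq_bigr => j _; congr (_ *: (_ *m _)).
    by apply/matrixP => a b; rewrite !mxE.
  apply/matrixP => a b; rewrite !mxE conjCK.
  by congr (P _ _).
rewrite (sumE (fun j => f (complex.Re (D 0 j)))) trmxCK.
set DF := diag_mx _; set LF := diag_mx _.
pose Q := P *m X.
have DQ : diag_mx D *m Q = Q *m diag_mx L.
  rewrite /Q -[RHS]mulmxA -AXL AE !mulmxA.
  by move/unitarymxP: PU => ->; rewrite mul1mx.
have fQ : DF *m Q = Q *m LF.
  apply/matrixP => a b; have /matrixP/(_ a b) := DQ.
  rewrite !mul_mx_diag !mul_diag_mx !mxE => /eqP.
  rewrite mulrC -subr_eq0 -mulrBr mulf_eq0 => /orP[/eqP->|].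
    by rewrite mulr0 mul0r.
  by rewrite subr_eq0 => /eqP->; rewrite mulrC.
have XX' : X *m X^t* = 1%:M by apply: mulmx1C.
rewrite -[LHS]mulmx1 -XX' !mulmxA -[_ *m P *m X]mulmxA -/Q -[_ *m DF *m Q]mulmxA.
by rewrite fQ /Q !mulmxA PP mul1mx.
Qed.

Definition orthonormal_basis_mx n (Y : {vspace 'cV[C]_n}) d (U : 'M[C]_(n, d))
  : Prop :=
  U^t* *m U = 1%:M /\
  forall v : 'cV_n, v \in Y <-> exists c : 'cV_d, v = U *m c.

Definition onb_mx n (Y : {vspace 'cV[C]_n}) : 'M[C]_(n, \dim Y) :=
  (schmidt (\matrix_(i < \dim Y) (tnth (vbasis Y) i)^T))^T.

Lemma onb_mxP n (Y : {vspace 'cV[C]_n}) : orthonormal_basis_mx Y (onb_mx Y).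
Proof.
rewrite /onb_mx; set B := \matrix_i _.
have mulB (c : 'rV_(\dim Y)) : (c *m B)^T = \sum_i c 0 i *: (vbasis Y)`_i.
  apply/matrixP => a b; rewrite summxE !mxE; apply: eq_bigr => i _.
  by rewrite !mxE (tnth_nth 0) ord1.
have Bfree : row_free B.
  rewrite -kermx_eq0; apply/eqP/row_matrixP => i.
  have := mulB (row i (kermx B)); rewrite -row_mul mulmx_ker row0 trmx0 => s0.
  have /freeP/(_ _ (esym s0)) k0 := basis_free (vbasisP Y).
  by apply/rowP => j; rewrite k0 row0 mxE.
have dn : (\dim Y <= n)%N by rewrite -(eqP Bfree) rank_leq_col.
split.
  have /unitarymxP/(congr1 trmx) := schmidt_unitarymx B dn.
  rewrite trmx_mul trmx1 => <-; congr (_ *m _).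
  by apply/matrixP => a b; rewrite !mxE.
move=> v.
have -> : v \in Y = (v^T <= B)%MS.
  apply/idP/idP => [vY|/submxP[c /(congr1 trmx)]].
    apply/submxP; exists (\row_i coord (vbasis Y) i v).
    apply: trmx_inj; rewrite mulB trmxK {1}(coord_vbasis vY).
    by apply: eq_bigr => i _; rewrite mxE.
  rewrite trmxK mulB => ->; apply: memv_suml => i _; apply: memvZ.
  by apply: vbasis_mem; rewrite mem_nth ?size_tuple.
rewrite -(eqmx_schmidt_free Bfree); split=> [/submxP[c e]|[c ->]].
  by exists c^T; rewrite -trmx_mul -e trmxK.
by rewrite trmx_mul trmxK submxMl.
Qed.

(* The dim Y Ritz values of A in Y, in decreasing order. *)
Definition ritz_values n (A : 'M[C]_n) (Y : {vspace 'cV[C]_n}) : seq R :=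
  eigenvalues ((onb_mx Y)^t* *m A *m onb_mx Y).

(* Indices start at 1: [ritz_value A Y 1] is the largest Ritz value. *)
Definition ritz_value n (A : 'M[C]_n) (Y : {vspace 'cV[C]_n}) (i : nat) : R :=
  (ritz_values A Y)`_i.-1.

Lemma ritz_valuesE n (A : 'M[C]_n) (Y : {vspace 'cV[C]_n}) d (U : 'M[C]_(n, d)) :
  orthonormal_basis_mx Y U -> ritz_values A Y = eigenvalues (U^t* *m A *m U).
Proof.
rewrite /ritz_values; move: (onb_mxP Y); move: (onb_mx Y); move: (\dim Y) => e.
have factor d1 d2 (V1 : 'M[C]_(n, d1)) (V2 : 'M[C]_(n, d2)) :
    orthonormal_basis_mx Y V1 -> orthonormal_basis_mx Y V2 ->
    V1 = V2 *m (V2^t* *m V1).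
  move=> [_ s1] [o2 s2]; apply/matrixP => a b.
  have /s2[c ec] : col b V1 \in Y.
    by apply/s1; exists (delta_mx b 0); rewrite colE.
  have : col b V1 = V2 *m (V2^t* *m col b V1).
    by rewrite ec [V2^t* *m _]mulmxA o2 mul1mx.
  by rewrite {2}colE !mulmxA -colE => /matrixP/(_ a 0); rewrite !mxE.
move=> V oV oU; pose Q := V^t* *m U; pose P := U^t* *m V.
have UE : U = V *m Q := factor _ _ _ _ oU oV.
have VE : V = U *m P := factor _ _ _ _ oV oU.
have PQ : P *m Q = 1%:M by rewrite /P -mulmxA -UE; case: oU.
have QP : Q *m P = 1%:M by rewrite /Q -mulmxA -VE; case: oV.
have dimE k l (M : 'M[C]_(k, l)) N : M *m N = 1%:M -> (k <= l)%N.
  by move=> MN; rewrite -(mxrank1 C k) -MN (leq_trans (mxrankM_maxl _ _)) ?rank_leq_col.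
have ed : e = d by apply/eqP; rewrite eqn_leq (dimE _ _ _ _ QP) (dimE _ _ _ _ PQ).
clear factor dimE; subst e.
suff -> : U^t* *m A *m U = P *m (V^t* *m A *m V) *m Q.
  by rewrite /eigenvalues char_poly_conj.
have QH : Q^t* = P by rewrite /Q trmx_mul map_mxM trmxCK.
rewrite {2}UE {1}UE trmx_mul map_mxM.
by rewrite QH !mulmxA.
Qed.

End Ritz.

(* Main.v *)
Require Import Defs.
From mathcomp Require Import all_boot all_order all_fingroup all_algebra ring lra.
From mathcomp Require Import complex reals.

Import Order.TTheory GRing.Theory Num.Theory.

Local Open Scope ring_scope.
Local Open Scope complex_scope.

(** Let lt = lambda_t, ls = lambda_(t+1), g = |f(lambda_t)|^2 and let m be the
    maximum of |f(lambda_j)|^2 over j > t, so that m < g.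

    The first i Ritz vectors span a subspace Z of Y, of dimension i, on which the
    Rayleigh quotient is at least eta ([ritz_subspace]). Since eta > ls, every
    nonzero z in Z has a component on some x_j with j <= t, where f(lambda_j) is
    nonzero; hence f(A) is injective on Z ([filter_eq0]) and f(A) Z is a subspace
    of Y' of dimension i. By the Courant-Fischer theorem ([ritz_value_ge]) it is
    then enough to bound the Rayleigh quotient from below on f(A) Z, vector by
    vector.

    Let a_j be the squared modulus of the component of z on x_j. The hypothesis
    is that the sum of the a_j (lambda_j - eta) is nonnegative, and the Rayleigh
    quotient of f(A) z is at least th as soon as the sum of the
    |f(lambda_j)|^2 a_j (lambda_j - th) is nonnegative. If eta < lt, choose th in
    ]ls, lt] by

      (lt - th) / (th - ls) = (m / g) (lt - eta) / (eta - ls).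

    For lambda_j >= lt, where |f(lambda_j)|^2 >= g, and for lambda_j <= ls, where
    |f(lambda_j)|^2 <= m, the coefficient |f(lambda_j)|^2 (lambda_j - th) is at
    least be (lambda_j - eta), with a factor be >= 0 that does not depend on j
    ([ritz_shift_below]); so the second sum is at least be times the first one
    ([filter_gap]). If eta >= lt, the same works with th = lt
    ([ritz_shift_above]).

    So eta' >= th in both cases. As (lt - x) / (x - ls) decreases with x > ls, this
    is the desired bound when eta' < lt ([shift_ratio_anti]). *)

Section RitzTheory.
Set Implicit Arguments.
Unset Strict Implicit.
Local Open Scope sesquilinear_scope.

Variable R : rcfType.
Local Notation C := R[i].
Local Notation normc := (@Normc.normc R).

(** * Eigenvectors in the order of the eigenvalues *)

Lemma unitary_expand m d (X : 'M[C]_d) (v : 'M[C]_(d, m)) :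
  X^t* *m X = 1%:M -> X *m (X^t* *m v) = v.
Proof. by move=> /mulmx1C XX; rewrite mulmxA XX mul1mx. Qed.

Lemma spectral_diag_Re d (M : 'M[C]_d) j : M \is hermsymmx ->
  (complex.Re (spectral_diag M 0 j))%:C = spectral_diag M 0 j.
Proof.
move=> hM; rewrite RRe_real //.
by have /mxOverP := hermitian_spectral_diag_real hM; apply.
Qed.

(** Both lists are the roots, with multiplicity, of the characteristic
    polynomial, which is invariant under the diagonalizing conjugation. *)
Lemma perm_eigenvalues d (M : 'M[C]_d) : M \is hermsymmx ->
  perm_eq (eigenvalues M)
    [seq complex.Re (spectral_diag M 0 j) | j <- enum 'I_d].
Proof.
move=> hM.
have inj : injective (@complex.real_complex R) by move=> a b [].
apply: (perm_map_inj inj); apply: prod_XsubC_eq.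
rewrite big_map -char_poly_eigenvalues // -map_comp big_map big_enum /=.
have /orthomx_spectralP {1}-> := hermitian_normalmx hM.
rewrite char_poly_conj ?mulVmx ?spectral_unit //.
rewrite char_poly_trig ?diag_mx_is_trig //.
by apply: eq_bigr => j _; rewrite /= spectral_diag_Re // mxE eqxx mulr1n.
Qed.

Lemma size_eigenvalues d (M : 'M[C]_d) : M \is hermsymmx ->
  size (eigenvalues M) = d.
Proof.
by move=> /perm_eigenvalues /perm_size ->; rewrite size_map size_enum_ord.
Qed.

Lemma eigval_anti d (M : 'M[C]_d) j k : M \is hermsymmx ->
  (0 < j)%N -> (j <= k <= d)%N -> eigval M k <= eigval M j.
Proof.
move=> hM j0 /andP[jk kd]; rewrite /eigval.
have ge_trans : transitive (>=%R : rel R) by move=> x y z /= xy /le_trans; exact.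
have k0 := leq_trans j0 jk.
apply: (@sorted_leq_nth _ (>=%R : rel R)) => //=.
- by move=> x; apply: lexx.
- by apply: sort_sorted => x y; apply: ge_total.
- by rewrite inE size_eigenvalues // prednK // (leq_trans jk).
- by rewrite inE size_eigenvalues // prednK.
- by rewrite -!subn1 leq_sub2r.
Qed.

(** The columns of X are orthonormal eigenvectors, the one of index j (from 0)
    belonging to [eigval M j.+1]. *)
Definition sorted_eigenbasis d (M X : 'M[C]_d) : Prop :=
  X^t* *m X = 1%:M /\
  M = X *m diag_mx (\row_j (eigval M j.+1)%:C) *m X^t*.

(** Permuting the orthonormal eigenvectors of the spectral theorem by the
    permutation that sorts their eigenvalues. *)
Lemma sorted_eigenbasis_ex d (M : 'M[C]_d) : M \is hermsymmx ->
  exists X, sorted_eigenbasis M X.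
Proof.
move=> hM.
have /eqP sz := size_eigenvalues hM.
have := perm_eigenvalues hM.
have -> : [seq complex.Re (spectral_diag M 0 j) | j <- enum 'I_d] =
    [tuple complex.Re (spectral_diag M 0 j) | j < d] by [].
case/tuple_permP=> s es.
have lam (j : 'I_d) : (eigval M j.+1)%:C = spectral_diag M 0 (s j).
  rewrite /eigval /= es (nth_map j) ?size_enum_ord ?ltn_ord //.
  by rewrite tnth_mktuple spectral_diag_Re // nth_ord_enum.
set P := spectralmx M.
have PU : P \is unitarymx := spectral_unitarymx M.
have /unitarymxP PP := PU.
have ME : M = P^t* *m diag_mx (spectral_diag M) *m P.
  by have /orthomx_spectralP {1}-> := hermitian_normalmx hM; rewrite invmx_unitary.
exists (\matrix_(a, b) P^t* a (s b)); split.
  apply/matrixP => a b; have /matrixP/(_ (s a) (s b)) := PP.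
  rewrite !mxE (inj_eq perm_inj) => <-; apply: eq_bigr => k _.
  by rewrite !mxE conjCK.
rewrite {1}ME !mul_mx_diag; apply/matrixP => a b; rewrite !mxE.
rewrite (reindex_perm s) /=; apply: eq_bigr => j _.
by rewrite !mxE conjCK lam.
Qed.

(** * The form v^* (M - th) v *)

(** For M Hermitian and v nonzero, this form is nonnegative exactly when the
    Rayleigh quotient of v is at least th; stating bounds on Rayleigh quotients
    through it avoids dividing by the norm of v, so that v = 0 needs no separate
    treatment. *)
Definition gap d (M : 'M[C]_d) (th : R) (v : 'cV[C]_d) : R :=
  complex.Re ((v^t* *m (M - th%:C%:M) *m v) 0 0).

Definition weight d (v : 'cV[C]_d) (j : 'I_d) : R := normc (v j 0) ^+ 2.

Lemma weight_ge0 d (v : 'cV[C]_d) j : 0 <= weight v j.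
Proof. exact: sqr_ge0. Qed.

Lemma mulJc (z : C) : (z^* * z)%R = (normc z ^+ 2)%:C.
Proof. by rewrite mulrC -sqr_normc rmorphXn. Qed.

(** In an eigenbasis the form is diagonal: this reduces every comparison of
    Rayleigh quotients below to a comparison of real coefficients. *)
Lemma gapE d (M X : 'M[C]_d) th v : sorted_eigenbasis M X ->
  gap M th v = \sum_(j < d) (eigval M j.+1 - th) * weight (X^t* *m v) j.
Proof.
case=> XX ME; rewrite /gap.
have -> : v^t* *m (M - th%:C%:M) *m v =
    (X^t* *m v)^t* *m diag_mx (\row_j (eigval M j.+1 - th)%:C) *m (X^t* *m v).
  have -> : diag_mx (\row_j (eigval M j.+1 - th)%:C) =
      diag_mx (\row_j (eigval M j.+1)%:C) - th%:C%:M :> 'M[C]_d.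
    by apply/matrixP => a b; rewrite !mxE rmorphB mulrnBl.
  rewrite trmx_mul map_mxM trmxCK !(mulmxBr, mulmxBl) !mul_mx_scalar.
  rewrite -!scalemxAl; congr (_ - _ *: _); first by rewrite {1}ME !mulmxA.
  by rewrite -mulmxA unitary_expand.
move: (X^t* *m v) => w.
rewrite mul_mx_diag !mxE raddf_sum /=; apply: eq_bigr => j _.
by rewrite !mxE /weight mulrAC mulJc -rmorphM /= mulrC.
Qed.

(** If v has no component on the eigenvectors with eigenvalue at least th, then
    all terms of the diagonal form are nonpositive, and strictly negative where v
    has a nonzero component; a nonnegative sum then leaves only v = 0. *)
Lemma gap_ge0_eq0 d (M X : 'M[C]_d) th v : sorted_eigenbasis M X ->
  0 <= gap M th v ->
  (forall j : 'I_d, th <= eigval M j.+1 -> (X^t* *m v) j 0 = 0) -> v = 0.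
Proof.
move=> MX; have [XX _] := MX; rewrite (gapE _ _ MX) => gap0 supp.
set w := X^t* *m v in gap0 supp *.
suff w0 : w = 0 by rewrite -(unitary_expand v XX) -/w w0 mulmx0.
have terms_ge0 (a : 'I_d) : true -> 0 <= (th - eigval M a.+1) * weight w a.
  move=> _; have [/supp wa|/ltW la_th] := leP th (eigval M a.+1).
    by rewrite /weight wa Normc.normc0 expr0n mulr0.
  by rewrite mulr_ge0 ?weight_ge0 ?subr_ge0.
have sum0 : \sum_(a < d) (th - eigval M a.+1) * weight w a = 0.
  apply/eqP; rewrite eq_le sumr_ge0 // andbT -oppr_ge0 -sumrN.
  by under eq_bigr do rewrite -mulNr opprB.
apply/matrixP => j k; rewrite ord1 [RHS]mxE.
have [/supp //|lam_th] := leP th (eigval M j.+1).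
have /eqP := psumr_eq0P terms_ge0 sum0 (i := j) isT.
rewrite mulf_eq0 subr_eq0 gt_eqF //= /weight sqrf_eq0 => /eqP.
exact: Normc.eq0_normc.
Qed.

(** * Courant-Fischer bounds *)

(** A subspace of dimension k is represented by a matrix W whose columns are a
    basis of it; independence is used as the injectivity of c |-> W c. *)
Definition injective_mx (F : fieldType) m k (W : 'M[F]_(m, k)) : Prop :=
  forall c : 'cV_k, W *m c = 0 -> c = 0.

Lemma wide_mx_kernel (F : fieldType) m k (N : 'M[F]_(m, k)) : (m < k)%N ->
  exists2 c : 'cV_k, c != 0 & N *m c = 0.
Proof.
move=> mk; have : kermx N^T != 0.
  rewrite -mxrank_eq0 mxrank_ker -lt0n subn_gt0.
  exact: leq_ltn_trans (rank_leq_col _) mk.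
case/rowV0Pn => v /sub_kermxP vN v0; exists v^T.
  by apply: contra v0 => /eqP v0; rewrite -[v]trmxK v0 trmx0.
by apply: trmx_inj; rewrite trmx_mul trmxK vN trmx0.
Qed.

Lemma injective_mx_leq (F : fieldType) m k (W : 'M[F]_(m, k)) :
  injective_mx W -> (k <= m)%N.
Proof.
move=> Winj; rewrite leqNgt; apply/negP => /(wide_mx_kernel W)[c c0 /Winj ce].
by rewrite ce eqxx in c0.
Qed.

(** The upper half of the Courant-Fischer theorem: the space W of dimension i
    contains a nonzero vector orthogonal to the first i - 1 eigenvectors, whose
    Rayleigh quotient cannot exceed the eigenvalue of index i. *)
Lemma eigval_ge d (M : 'M[C]_d) i (W : 'M[C]_(d, i)) th :
    M \is hermsymmx -> (0 < i)%N -> injective_mx W ->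
    (forall c, 0 <= gap M th (W *m c)) ->
  th <= eigval M i.
Proof.
move=> hM i0 Winj Wgap; rewrite leNgt; apply/negP => lt_th.
have id := injective_mx_leq Winj.
have [X MX] := sorted_eigenbasis_ex hM.
have i1d : (i.-1 <= d)%N := leq_trans (leq_pred i) id.
pose N := \matrix_(a < i.-1, b < i) (X^t* *m W) (widen_ord i1d a) b.
(* N is made of the first i - 1 rows of X^t* W, so that its kernel gives the
   vectors of W orthogonal to the first i - 1 eigenvectors. *)
have [|c c0 Nc] := wide_mx_kernel N; first by rewrite prednK.
case/eqP: c0; apply: Winj; apply: (gap_ge0_eq0 MX (Wgap c)) => j th_j.
have ji : (j < i.-1)%N.
  rewrite ltnNge; apply/negP => ij.
  suff le_i : eigval M j.+1 <= eigval M i.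
    by have := le_lt_trans (le_trans th_j le_i) lt_th; rewrite ltxx.
  by apply: eigval_anti => //; rewrite ltn_ord andbT -(prednK i0).
have Nc0 : (N *m c) (Ordinal ji) 0 = 0 by rewrite Nc mxE.
rewrite mulmxA mxE -[RHS]Nc0 mxE; apply: eq_bigr => b _.
by rewrite [N _ _]mxE; congr ((_ *m _) _ _ * _); apply: val_inj.
Qed.

(** The other half of the Courant-Fischer theorem: the first i eigenvectors span
    a space on which the Rayleigh quotient is at least the eigenvalue of
    index i. *)
Lemma eigval_attained d (M : 'M[C]_d) i :
    M \is hermsymmx -> (i <= d)%N ->
  exists2 W : 'M[C]_(d, i),
    injective_mx W & forall c, 0 <= gap M (eigval M i) (W *m c).
Proof.
move=> hM id; have [X MX] := sorted_eigenbasis_ex hM; have [XX _] := MX.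
have XW (c : 'cV_i) : X^t* *m (X *m pid_mx i *m c) = pid_mx i *m c.
  by rewrite !mulmxA XX mul1mx.
exists (X *m pid_mx i) => c.
  move/(congr1 (mulmx (X^t*))); rewrite XW mulmx0.
  move/(congr1 (mulmx (pid_mx i : 'M_(i, d)))).
  by rewrite mulmxA pid_mx_id // pid_mx_1 mul1mx mulmx0.
rewrite (gapE _ _ MX) sumr_ge0 // => j _; rewrite XW.
have [ji|ij] := ltnP j i.
  by rewrite mulr_ge0 ?weight_ge0 // subr_ge0 eigval_anti // ji id.
suff -> : weight (pid_mx i *m c) j = 0 by rewrite mulr0.
rewrite /weight mxE big1 ?Normc.normc0 ?expr0n // => b _.
by rewrite mxE ltnNge ij andbF mul0r.
Qed.

(** * Ritz values *)

Lemma gap_compress n d (A : 'M[C]_n) (U : 'M[C]_(n, d)) th c :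
  U^t* *m U = 1%:M -> gap (U^t* *m A *m U) th c = gap A th (U *m c).
Proof.
move=> UU; rewrite /gap; congr (complex.Re (fun_of_matrix _ _ _)).
rewrite trmx_mul map_mxM !(mulmxBr, mulmxBl) !mul_mx_scalar -!scalemxAl !mulmxA.
by rewrite -[_ *m U^t* *m U]mulmxA UU mulmx1.
Qed.

Lemma hermitian_compress n d (A : 'M[C]_n) (U : 'M[C]_(n, d)) :
  A \is hermsymmx -> U^t* *m A *m U \is hermsymmx.
Proof.
move=> /is_hermitianmxP; rewrite expr0 scale1r => AE.
apply/is_hermitianmxP; rewrite expr0 scale1r.
by rewrite !trmx_mul !map_mxM trmxCK -AE mulmxA.
Qed.

(** The witness is spanned by the first i Ritz vectors, brought back to the
    ambient space by the orthonormal basis of Y. *)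
Lemma ritz_subspace n (A : 'M[C]_n) (Y : {vspace 'cV[C]_n}) i :
    A \is hermsymmx -> (i <= \dim Y)%N ->
  exists Z : 'M[C]_(n, i), [/\ injective_mx Z, forall c, Z *m c \in Y &
    forall c, 0 <= gap A (ritz_value A Y i) (Z *m c)].
Proof.
move=> hA iY; have [UU UY] := onb_mxP Y.
have [W Winj Wgap] := eigval_attained (hermitian_compress (onb_mx Y) hA) iY.
exists (onb_mx Y *m W); split=> c.
- move/(congr1 (mulmx ((onb_mx Y)^t*))); rewrite mulmx0 !mulmxA UU mul1mx.
  exact: Winj.
- by apply/UY; exists (W *m c); rewrite mulmxA.
- by rewrite -mulmxA -gap_compress //; apply: Wgap.
Qed.

(** The counterpart of [eigval_ge] for a compression, with the test space given
    in the ambient space; the inequality on the dimension comes with it because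
    the test space is contained in Y. *)
Lemma ritz_value_ge n (A : 'M[C]_n) (Y : {vspace 'cV[C]_n}) i
    (Z : 'M[C]_(n, i)) th :
    A \is hermsymmx -> (0 < i)%N -> injective_mx Z ->
    (forall c, Z *m c \in Y) -> (forall c, 0 <= gap A th (Z *m c)) ->
  (i <= \dim Y)%N /\ th <= ritz_value A Y i.
Proof.
move=> hA i0 Zinj ZY Zgap; have [UU UY] := onb_mxP Y.
set U := onb_mx Y in UU UY.
have UZ (c : 'cV_i) : U *m (U^t* *m Z *m c) = Z *m c.
  have /UY[e Ze] := ZY c.
  by rewrite -mulmxA Ze [U^t* *m _]mulmxA UU mul1mx.
have Winj : injective_mx (U^t* *m Z).
  by move=> c Wc; apply: Zinj; rewrite -UZ Wc mulmx0.
split; first exact: injective_mx_leq Winj.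
apply: (eigval_ge (hermitian_compress U hA) i0 Winj) => c.
by rewrite gap_compress // UZ.
Qed.

(** * The effect of f(A) on a vector *)

Lemma matfun_coord n (f : R -> C) (A X : 'M[C]_n) (v : 'cV_n) j :
    A \is hermsymmx -> sorted_eigenbasis A X ->
  (X^t* *m (matfun f A *m v)) j 0 = f (eigval A j.+1) * (X^t* *m v) j 0.
Proof.
move=> hA [XX AE].
have Xcol k : X^t* *m col k X = delta_mx k 0.
  by rewrite colE mulmxA XX mul1mx.
have AX k : A *m col k X = (eigval A k.+1)%:C *: col k X.
  rewrite {1}AE -!mulmxA Xcol mulmxA -colE mul_mx_diag.
  by apply/matrixP => a b; rewrite !mxE mulrC.
rewrite (matfunE f hA XX AX) mulmx_suml mulmx_sumr summxE.
have term (k : 'I_n) :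
    (X^t* *m (f (eigval A k.+1) *: (col k X *m (col k X)^t*) *m v)) j 0 =
      f (eigval A k.+1) * ((j == k)%:R * (X^t* *m v) k 0).
  rewrite -!(scalemxAl, scalemxAr) mxE -!mulmxA [X^t* *m (col k X *m _)]mulmxA Xcol.
  rewrite [in LHS]mxE big_ord1 !mxE eqxx andbT.
  by congr (_ * (_ * _)); apply: eq_bigr => b _; rewrite !mxE.
under eq_bigr do rewrite term.
rewrite (bigD1 j) //= eqxx mul1r big1 ?addr0 // => k /negPf kj.
by rewrite eq_sym kj mul0r mulr0.
Qed.

(** Applying f(A) multiplies the weight of the eigenvalue x by |f(x)|^2, so it is
    enough to compare, up to one common factor be, the coefficients x - eta
    before and |f(x)|^2 (x - th) after. *)
Lemma filter_gap n (f : R -> C) (A X : 'M[C]_n) eta th be v :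
    A \is hermsymmx -> sorted_eigenbasis A X -> 0 <= be ->
    (forall j : 'I_n, be * (eigval A j.+1 - eta) <=
       normc (f (eigval A j.+1)) ^+ 2 * (eigval A j.+1 - th)) ->
  0 <= gap A eta v -> 0 <= gap A th (matfun f A *m v).
Proof.
move=> hA AX be0 pointwise gap0; rewrite (gapE _ _ AX).
apply: le_trans (mulr_ge0 be0 gap0) _; rewrite (gapE _ _ AX) mulr_sumr.
apply: ler_sum => j _; rewrite mulrA.
have -> : weight (X^t* *m (matfun f A *m v)) j =
    normc (f (eigval A j.+1)) ^+ 2 * weight (X^t* *m v) j.
  by rewrite /weight (matfun_coord _ _ _ hA AX) Normc.normcM exprMn.
by rewrite [leRHS]mulrCA [leRHS]mulrA ler_wpM2r ?weight_ge0.
Qed.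

(** A vector with Rayleigh quotient at least eta has a component on an
    eigenvalue at least eta, and f(A) does not annihilate that component. *)
Lemma filter_eq0 n (f : R -> C) (A X : 'M[C]_n) eta v :
    A \is hermsymmx -> sorted_eigenbasis A X ->
    (forall j : 'I_n, eta <= eigval A j.+1 -> f (eigval A j.+1) != 0) ->
    0 <= gap A eta v -> matfun f A *m v = 0 -> v = 0.
Proof.
move=> hA AX fn0 gap0 fv0; apply: (gap_ge0_eq0 AX gap0) => j eta_j.
have := matfun_coord f v j hA AX; rewrite fv0 mulmx0 mxE => /esym/eqP.
by rewrite mulf_eq0 (negPf (fn0 j eta_j)) => /eqP.
Qed.

End RitzTheory.

(** * The scalar comparison *)

(** The shift th is the point of ]ls, lt] whose ratio is m / g times the ratio of
    eta. With D = g (eta - ls) + m (lt - eta) and r = (lt - ls) / D, this amounts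
    to th - ls = g (eta - ls) r and lt - th = m (lt - eta) r. The factor
    be = g m r makes be (x - eta) agree with g (x - th) at x = lt and with
    m (x - th) at x = ls; both inequalities then reduce to a comparison of
    slopes, m r <= 1 above lt and 1 <= g r below ls. *)
Lemma ritz_shift_below (F : realFieldType) (lt ls eta m g : F) :
    0 <= m < g -> ls < eta < lt ->
  exists th be : F,
    [/\ 0 <= be, ls < th,
       (lt - th) / (th - ls) = m / g * ((lt - eta) / (eta - ls)),
       forall x h, lt <= x -> g <= h -> be * (x - eta) <= h * (x - th)
     & forall x h, x <= ls -> h <= m -> be * (x - eta) <= h * (x - th)].
Proof.
move=> /andP[m0 mg] /andP[ls_eta eta_lt].
have D0 : 0 < g * (eta - ls) + m * (lt - eta).
  by apply: ltr_pwDl; [apply: mulr_gt0; lra | apply: mulr_ge0; lra].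
set D := _ + _ in D0.
have [r r0 rD] : exists2 r, 0 < r & r * D = lt - ls.
  by exists ((lt - ls) / D); [apply: divr_gt0; lra | rewrite mulfVK // gt_eqF].
have g0 : 0 < g by lra.
exists (ls + g * (eta - ls) * r), (g * m * r).
set th := ls + _.
have th_ls : th - ls = g * (eta - ls) * r by rewrite /th; ring.
have lt_th : lt - th = m * (lt - eta) * r.
  have -> : lt - th = r * D - g * (eta - ls) * r by rewrite rD /th; ring.
  by rewrite /D; ring.
have p0 : 0 < g * (eta - ls) * r by rewrite !mulr_gt0 //; lra.
have q0 : 0 <= m * (lt - eta) * r by rewrite !mulr_ge0 //; lra.
split.
- by rewrite !mulr_ge0 //; lra.
- lra.
- rewrite lt_th th_ls; field; rewrite !gt_eqF //; lra.
- move=> x h lt_x g_h.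
  have mr1 : m * r <= 1.
    rewrite -(ler_pM2r D0) -mulrA rD mul1r -subr_ge0.
    have -> : D - m * (lt - ls) = (g - m) * (eta - ls) by rewrite /D; ring.
    by apply: mulr_ge0; lra.
  apply: (@le_trans _ _ (g * (x - th))); last by apply: ler_wpM2r => //; lra.
  have -> : g * (x - th) = g * ((x - lt) + m * (lt - eta) * r).
    by rewrite -lt_th; ring.
  rewrite -subr_ge0.
  have -> : g * (x - lt + m * (lt - eta) * r) - g * m * r * (x - eta) =
    g * ((x - lt) * (1 - m * r)) by ring.
  by rewrite !mulr_ge0 //; lra.
- move=> x h x_ls h_m.
  have gr1 : 1 <= g * r.
    rewrite -(ler_pM2r D0) -mulrA rD mul1r -subr_ge0.
    have -> : g * (lt - ls) - D = (g - m) * (lt - eta) by rewrite /D; ring.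
    by apply: mulr_ge0; lra.
  apply: (@le_trans _ _ (m * (x - th))); last by apply: ler_wnM2r => //; lra.
  rewrite -subr_ge0.
  have -> : m * (x - th) - g * m * r * (x - eta) = m * ((ls - x) * (g * r - 1)).
    by rewrite /th; ring.
  by rewrite !mulr_ge0 //; lra.
Qed.

(** When eta is already at least lt, the same comparison holds with th = lt and
    common factor g. *)
Lemma ritz_shift_above (F : realFieldType) (lt ls eta m g : F) :
    0 <= m < g -> ls <= lt <= eta ->
  [/\ forall x h, lt <= x -> g <= h -> g * (x - eta) <= h * (x - lt)
     & forall x h, x <= ls -> h <= m -> g * (x - eta) <= h * (x - lt)].
Proof.
move=> /andP[m0 mg] /andP[ls_lt lt_eta].
have shift x : g * (x - eta) <= g * (x - lt) by apply: ler_wpM2l; lra.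
split=> x h x_le h_le; apply: le_trans (shift x) _.
  by apply: ler_wpM2r; lra.
by apply: ler_wnM2r; lra.
Qed.

Lemma shift_ratio_anti (F : realFieldType) (lt ls th th' : F) :
    ls < th -> th <= th' -> th' < lt ->
  0 < (lt - th') / (th' - ls) <= (lt - th) / (th - ls).
Proof.
move=> ls_th th_th' th'_lt; apply/andP; split; first by apply: divr_gt0; lra.
apply: ler_pM; rewrite ?invr_ge0 ?lef_pV2 ?posrE; lra.
Qed.

(** * Ritz values after applying a matrix function *)

Theorem theorem3p6 (R : realType) (n : nat) (A : 'M[R[i]]_n)
    (Y : {vspace 'cV[R[i]]_n}) (f : R -> R[i]) (i t : nat) :
  let p := \dim Y in
  let Y' := (linfun (mulmx (matfun f A)) @: Y)%VS in
  let lambda := eigval A in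
  let absf (j : nat) := Normc.normc (f (lambda j)) in
  let maxf := \big[Num.max/0]_(t.+1 <= j < n.+1) absf j in
  let eta := ritz_value A Y i in
  let eta' := ritz_value A Y' i in
  A \is hermsymmx ->
  (1 <= p)%N ->
  (1 <= i <= p)%N ->
  (i <= t <= n - p + i - 1)%N ->
  lambda t.+1 < eta ->
  (forall j : nat, (1 <= j < t)%N -> absf j.+1 <= absf j) ->
  maxf < absf t ->
  (i <= \dim Y')%N /\
  (lambda t <= eta' \/
   0 < (lambda t - eta') / (eta' - lambda t.+1) <=
     (maxf ^+ 2 / absf t ^+ 2) * ((lambda t - eta) / (eta - lambda t.+1))).
Proof.
move=> p Y' lambda absf maxf eta eta' hA _ /andP[i0 ip] /andP[it tn].
move=> ls_eta absf_anti maxf_lt.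
(* As t < n, the eigenvalue of index t + 1 is a genuine one, not the default
   value of the list. *)
have pn : (p <= n)%N by have := dimvS (subvf Y); rewrite dimvf /dim /= muln1.
have t0 : (0 < t)%N := leq_trans i0 it.
have t1n : (t.+1 <= n)%N.
  apply: leq_ltn_trans tn _; rewrite subn1 prednK ?addn_gt0 ?i0 ?orbT //.
  by rewrite -(leq_add2l (n - p)) subnK // in ip.
have [X AX] := sorted_eigenbasis_ex hA.
have maxf_ge0 : 0 <= maxf by apply: bigmax_ge_id.
have absf_ge0 j : 0 <= absf j.
  by rewrite /absf; case: (f _) => a b /=; apply: sqrtr_ge0.
have absf_head j : (0 < j <= t)%N -> absf t <= absf j.
  move=> /andP[j0 jt]; rewrite -(subnKC jt).
  have : (j + (t - j) <= t)%N by rewrite subnKC.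
  elim: (t - j)%N => [|k IHk]; first by rewrite addn0.
  rewrite addnS => jkt; apply: le_trans (IHk (ltnW jkt)).
  by apply: absf_anti; rewrite jkt addn_gt0 j0.
have absf_tail j : (t < j <= n)%N -> absf j <= maxf.
  by move=> tj; apply: le_bigmax_seq => //; rewrite mem_index_iota.
have mg : 0 <= maxf ^+ 2 < absf t ^+ 2.
  by rewrite exprn_ge0 //= ltrXn2r // nnegrE (le_trans maxf_ge0) // ltW.
have [Z [Zinj ZY Zgap]] := ritz_subspace hA ip.
have filtered_bound th be : 0 <= be ->
    (forall x h, lambda t <= x -> absf t ^+ 2 <= h ->
       be * (x - eta) <= h * (x - th)) ->
    (forall x h, x <= lambda t.+1 -> h <= maxf ^+ 2 ->
       be * (x - eta) <= h * (x - th)) ->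
    (i <= \dim Y')%N /\ th <= eta'.
  move=> be0 head tail.
  apply: (@ritz_value_ge _ _ _ _ _ (matfun f A *m Z)) => //.
  - move=> c; rewrite -mulmxA => fZc; apply: Zinj.
    apply: (filter_eq0 hA AX _ (Zgap c) fZc) => j eta_j.
    apply: contraTneq maxf_lt => fj0; rewrite -leNgt.
    apply: le_trans maxf_ge0.
    have : absf j.+1 = 0 by rewrite /absf /lambda fj0 Normc.normc0.
    move=> <-; apply: absf_head; rewrite /= ltnNge; apply/negP => tj.
    have := lt_le_trans ls_eta eta_j; rewrite ltNge /lambda.
    by rewrite eigval_anti // ltnS tj /= ltn_ord.
  - by move=> c; rewrite -mulmxA -[_ *m _](lfunE (mulmx (matfun f A))) memv_img.
  - move=> c; rewrite -mulmxA; apply: (filter_gap hA AX be0 _ (Zgap c)) => j.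
    have [jt|tj] := ltnP j t.
      apply: head; first by apply: eigval_anti; rewrite // jt ltnW.
      by rewrite lerXn2r ?nnegrE ?absf_ge0 ?(absf_head j.+1).
    apply: tail; first by apply: eigval_anti; rewrite // ltnS tj ltn_ord.
    by rewrite lerXn2r ?nnegrE ?maxf_ge0 ?absf_ge0 ?(absf_tail j.+1) ?ltnS ?tj /=.
have [eta_lt|lt_eta] := ltP eta (lambda t); last first.
  have [|above below] := @ritz_shift_above _ (lambda t) (lambda t.+1) eta _ _ mg.
    by rewrite lt_eta andbT eigval_anti // leqnSn.
  have [|? ?] := filtered_bound _ _ _ above below; first exact: sqr_ge0.
  by split; [|left].
have [|th [be [be0 ls_th <- above below]]] :=
  @ritz_shift_below _ (lambda t) (lambda t.+1) eta _ _ mg.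
  by rewrite ls_eta.
have [? th_eta'] := filtered_bound _ _ be0 above below; split=> //.
have [|eta'_lt] := leP (lambda t) eta'; [by left | right].
exact: shift_ratio_anti.
Qed.
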